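(* Let $\kappa > 0$ be a cardinal and let $F$ be a topological group whose underlying group is free of rank $\kappa$. Then the following are equivalent. (1) The topology on $F$ is non-discrete. (2) $F$ is almost $\kappa$-free. Moreover, when these equivalent conditions hold, if $2 \leq \kappa \leq \aleph_0$, then $F$ is almost countably free.
   Context: Topological groups are not assumed to be Hausdorff. For a cardinal $\kappa>0$ and a group $G$, let $G_\kappa$ denote the set of $\kappa$-tuples $(g_i)_{i\in\kappa}\in G^\kappa$ that freely generate a free subgroup of $G$, i.e. such that no nontrivial reduced group word in the indexed variables $(x_i)_{i\in\kappa}$ evaluates to $1$ at $(g_i)_{i\in\kappa}$ (equivalently, the homomorphism from the free group on $\{x_i\}_{i\in\kappa}$ to $G$ sending $x_i\mapsto g_i$ is injective). An infinite topological group $G$ is called almost $\kappa$-free if $G_\kappa$ is dense in $G^\kappa$ with the product topology. ''Almost countably free'' means almost $\aleph_0$-free. *)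

(* Defs.v *)
From HB Require Import structures.
From mathcomp Require Import all_boot monoid.
From mathcomp Require Import all_classical topology.

Set Implicit Arguments.
Unset Strict Implicit.
Unset Printing Implicit Defensive.

Local Open Scope classical_set_scope.
Local Open Scope group_scope.

(* No separation axiom is imposed. *)
HB.mixin Record isTopologicalGroup G of Group G & Topological G := {
  mulg_continuous : continuous (fun x : G * G => x.1 * x.2) ;
  invg_continuous : continuous (fun x : G => x^-1)
}.

#[short(type="topologicalGroupType")]
HB.structure Definition TopologicalGroup :=
  {G of Group G & Topological G & isTopologicalGroup G}.

(* Group words in the variables (x_i)_{i : K}, where K is an arbitrary type
   standing for the cardinal |K|: the letter (i, true) is x_i and the letter
   (i, false) is x_i^-1. *)
Definition word (K : Type) := seq (K * bool).

(* No letter is adjacent to its inverse: neighbours on the same variable carry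
   the same exponent. *)
Definition reduced (K : Type) (w : word K) : bool :=
  sorted (fun a b : K * bool => `[< a.1 = b.1 -> a.2 = b.2 >]) w.

Definition word_eval (K : Type) (G : groupType) (g : K -> G) (w : word K) : G :=
  \prod_(a <- w) (if a.2 then g a.1 else (g a.1)^-1).

(* The set G_kappa, for kappa = |K|. *)
Definition free_tuples (K : Type) (G : groupType) : set (K -> G) :=
  [set g | forall w : word K, reduced w -> w <> [::] -> word_eval g w <> 1].

(* G has a basis, i.e. a free generating family, indexed by K. *)
Definition free_of_rank (K : Type) (G : groupType) : Prop :=
  exists2 x : K -> G, free_tuples x &
    forall y : G, exists w : word K, word_eval x w = y.

Definition almost_free (K : Type) (G : topologicalGroupType) : Prop :=
  infinite_set [set: G] /\
  dense (@free_tuples K G : set {ptws K -> G}).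

Definition almost_countably_free (G : topologicalGroupType) : Prop :=
  almost_free nat G.

(* Main.v *)
Require Import Defs.
From HB Require Import structures.
From mathcomp Require Import all_boot monoid.
From mathcomp Require Import all_classical topology.

Set Implicit Arguments.
Unset Strict Implicit.
Unset Printing Implicit Defensive.

Local Open Scope classical_set_scope.
Local Open Scope group_scope.

(* If all sets are open, the tuples with a fixed coordinate equal to 1 form an open
   set without free tuples.  Conversely, let p <> q be basis elements, g a tuple
   indexed by L and u <> 1 close to 1.  For a suitable t among p, q, q p^-1, the
   reduced word of v = t u t^-1 starts with a positive and ends with a negative
   letter.  Perturb g_l to h_l = X_l v X_l^-1 g_l Y_l v Y_l^-1, where
   X_l = p c_l p^n and Y_l = q c_l q^m are positive words, no two of which are
   comparable for the prefix order, with n and m (depending on l) so large that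
   X_l^-1 g_l Y_l starts with a negative and ends with a positive letter.  Then
   h_l maps to words with prefix X_l all words with a prefix other than Y_l, and
   symmetrically for h_l^-1, so h is free by ping-pong.  Only a prefix code c on
   the basis indexed by L is needed: single letters if L indexes the basis,
   p^l q if L = nat.  A group of rank one is torsion-free, which makes every tuple
   with entry different from 1 free. *)

(** * Reduced words and the signs of their extremal letters *)

Section Words.
Context {K : Type}.
Implicit Types (a b : K * bool) (s t w : word K) (e : bool).

Definition first_sign w : option bool := ohead (map snd w).

Definition last_sign w : option bool := first_sign (rev w).

Definition inv_word w : word K := rev [seq (a.1, ~~ a.2) | a <- w].

Definition pos_word (X : seq K) : word K := [seq (k, true) | k <- X].

Lemma first_sign_inv w : first_sign (inv_word w) = omap negb (last_sign w).
Proof.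
by rewrite /last_sign /inv_word -map_rev; case: (rev w).
Qed.

Lemma last_sign_inv w : last_sign (inv_word w) = omap negb (first_sign w).
Proof. by rewrite /last_sign /inv_word revK; case: w. Qed.

Lemma first_sign_cat s t e : first_sign s = Some e -> first_sign (s ++ t) = Some e.
Proof. by case: s. Qed.

Lemma last_sign_pos X : X <> [::] -> last_sign (pos_word X) = Some true.
Proof.
case/lastP: X => // X k _.
by rewrite /last_sign /pos_word map_rcons rev_rcons.
Qed.

Lemma reduced_rcons_cons s a b t :
  reduced (rcons s a ++ b :: t) =
    [&& reduced (rcons s a), `[< a.1 = b.1 -> a.2 = b.2 >] & reduced (b :: t)].
Proof. by rewrite cat_rcons /reduced sorted_cat_cons /=. Qed.

Lemma reduced_cons2 a b t :
  reduced [:: a, b & t] =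
    `[< a.1 = b.1 -> a.2 = b.2 >] && reduced (b :: t).
Proof. by []. Qed.

Lemma reduced_cat s t e : reduced s -> reduced t ->
  last_sign s = Some e -> first_sign t = Some e -> reduced (s ++ t).
Proof.
case/lastP: s => // s a; case: t => // b t rs rt.
rewrite /last_sign rev_rcons /first_sign /= => -[ae] [be].
rewrite reduced_rcons_cons rs rt andbT /=.
by apply/asboolP => _; rewrite ae be.
Qed.

Lemma reduced_catl s t : reduced (s ++ t) -> reduced s.
Proof.
case/lastP: s => // s a; case: t => [|b t]; first by rewrite cats0.
by rewrite reduced_rcons_cons => /and3P[].
Qed.

Lemma reduced_catr s t : reduced (s ++ t) -> reduced t.
Proof.
case/lastP: s => // s a; case: t => // b t.
by rewrite reduced_rcons_cons => /and3P[].
Qed.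

Lemma reduced_inv w : reduced w -> reduced (inv_word w).
Proof.
rewrite /inv_word /reduced rev_sorted sorted_map.
apply: sub_sorted => a b /asboolP ab; apply/asboolP => /= ba.
by rewrite ab.
Qed.

Lemma reduced_pos X : reduced (pos_word X).
Proof.
elim: X => // k [|k' X] //= IH; apply/andP; split => //.
exact/asboolP.
Qed.

Lemma reduced_nseq n a : reduced (nseq n a).
Proof. by case: n => // n; elim: n => //= n ->; rewrite andbT; apply/asboolP. Qed.

End Words.

(** * Evaluation of words and the ping-pong criterion *)

Section Evaluation.
Context {K : Type} {G : groupType}.
Implicit Types (x : K -> G) (s t w : word K).

Lemma word_eval_nil x : word_eval x [::] = 1.
Proof. exact: big_nil. Qed.

Lemma word_eval_cons x a w :
  word_eval x (a :: w) = (if a.2 then x a.1 else (x a.1)^-1) * word_eval x w.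
Proof. exact: big_cons. Qed.

Lemma word_eval_cat x s t :
  word_eval x (s ++ t) = word_eval x s * word_eval x t.
Proof. exact: big_cat. Qed.

Lemma word_eval_inv x w : word_eval x (inv_word w) = (word_eval x w)^-1.
Proof.
elim: w => [|a w IH]; first by rewrite /inv_word /= word_eval_nil invg1.
rewrite /inv_word /= rev_cons -cats1 word_eval_cat -/(inv_word w) IH.
rewrite !word_eval_cons word_eval_nil /= invgM mulg1.
by case: a.2; rewrite ?invgK.
Qed.

(** A letter put in front of a reduced word either keeps it reduced or is inverse to its first
    letter, and then both are deleted. *)
Lemma word_eval_reduced x w : exists2 r, reduced r & word_eval x r = word_eval x w.
Proof.
elim: w => [|[k e] w [r rr rE]]; first by exists [::].
rewrite word_eval_cons -rE; case: r rr {rE} => [|[k' e'] r] rr.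
  by exists [:: (k, e)]; rewrite ?word_eval_cons.
have [kk'|kk'] := pselect (k = k'); last first.
  exists [:: (k, e), (k', e') & r]; rewrite ?word_eval_cons //.
  by rewrite reduced_cons2 rr andbT; apply/asboolP.
have [ee'|/negP/negbTE ee'] := pselect (e == e').
  exists [:: (k, e), (k', e') & r]; rewrite ?word_eval_cons //.
  by rewrite reduced_cons2 rr andbT (eqP ee'); apply/asboolP.
exists r; first exact: (@reduced_catr _ [:: (k', e')]).
rewrite word_eval_cons /= kk'.
by case: e e' ee' {rr} => [] [] //= _; rewrite ?mulKg ?mulVKg.
Qed.

(** By induction, the value of every reduced word with first letter [a] lies in [P a], which avoids
    1. One-letter words start the induction, in place of a base point. *)
Lemma ping_pong (h : K -> G) (P : K * bool -> set G) :
  (forall a, ~ P a 1) ->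
  (forall a, P a (if a.2 then h a.1 else (h a.1)^-1)) ->
  (forall a b y, reduced [:: a; b] -> P b y ->
     P a ((if a.2 then h a.1 else (h a.1)^-1) * y)) ->
  free_tuples h.
Proof.
move=> P1 Ph PM [//|a w] rw _ h1; apply: (P1 a); rewrite -h1.
elim: w a rw {h1} => [|b w IH] a rw; rewrite word_eval_cons.
  by rewrite word_eval_nil mulg1.
apply: (PM _ b); first exact: (@reduced_catl _ [:: a; b] w).
by apply: IH; exact: (@reduced_catr _ [:: a] _).
Qed.

End Evaluation.

(** * Elements described by the ends of a reduced word *)

Section SignedElements.
Context {K : Type} {F : groupType} (x : K -> F).
Implicit Types (y z : F) (e : bool) (X Y : seq K).

(* Letters of the same sign never cancel, so only the signs of the two extremal
   letters of a reduced word have to be recorded. *)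
Definition begins e y :=
  exists w, [/\ reduced w, first_sign w = Some e & word_eval x w = y].

Definition switches e y := exists w,
  [/\ reduced w, first_sign w = Some e, last_sign w = Some (~~ e) &
      word_eval x w = y].

Definition has_prefix X y :=
  exists r, reduced (pos_word X ++ r) /\ word_eval x (pos_word X ++ r) = y.

(** This refers to the prefix order: two lists are comparable exactly when they have a common
    extension. *)
Definition incomparable X Y := forall r s, X ++ r <> Y ++ s.

Lemma switches_inv e y : switches e y -> switches e y^-1.
Proof.
move=> [w [rw fw lw <-]]; exists (inv_word w).
rewrite word_eval_inv reduced_inv // first_sign_inv last_sign_inv fw lw.
by rewrite /= negbK.
Qed.

Lemma switches_mul e y z : switches e y -> begins (~~ e) z -> begins e (y * z).
Proof.
move=> [w [rw fw lw <-]] [r [rr fr <-]]; exists (w ++ r).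
split; [exact: reduced_cat lw fr|exact: first_sign_cat|].
exact: word_eval_cat.
Qed.

Lemma has_prefix_mul X y :
  X <> [::] -> begins true y -> has_prefix X (word_eval x (pos_word X) * y).
Proof.
move=> X0 [r [rr fr <-]]; exists r; rewrite word_eval_cat; split=> //.
exact: reduced_cat (reduced_pos _) rr (last_sign_pos X0) fr.
Qed.

Lemma begins_inv X : X <> [::] -> begins false (word_eval x (pos_word X))^-1.
Proof.
move=> X0; exists (inv_word (pos_word X)); rewrite word_eval_inv.
rewrite reduced_inv ?reduced_pos //.
by rewrite first_sign_inv last_sign_pos.
Qed.

(** Common first letters of [X] and [Y] cancel. By incomparability this stops with both remainders
    nonempty, where two different variables meet and nothing more cancels. *)
Lemma begins_inv_mul X Y y : incomparable X Y -> has_prefix X y ->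
  begins false ((word_eval x (pos_word Y))^-1 * y).
Proof.
elim: Y X y => [|k Y IH] [|k' X] y.
- by move=> /(_ [::] [::]).
- by move=> /(_ [::] (k' :: X)); rewrite cats0.
- by move=> /(_ (k :: Y) [::]); rewrite cats0.
move=> XY [r [rr <-]].
have [kk'|kk'] := pselect (k = k').
  rewrite /= !word_eval_cons invgM -mulgA kk' mulKg; apply: (IH X).
    by move=> r' s' /(congr1 (cons k')); rewrite -!cat_cons -{2}kk'; apply: XY.
  by exists r; split=> //; exact: (@reduced_catr _ [:: (k', true)]).
exists (inv_word (pos_word (k :: Y)) ++ (pos_word (k' :: X) ++ r)).
rewrite word_eval_cat word_eval_inv; split => //.
- have := @reduced_inv _ _ (reduced_pos (k :: Y)).
  rewrite /inv_word [map _ (pos_word _)]/= rev_cons => rY.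
  rewrite [pos_word (k' :: X)]/= cat_cons reduced_rcons_cons rY /=.
  by apply/andP; split=> //; apply/asboolP.
- by apply: first_sign_cat; rewrite first_sign_inv last_sign_pos.
Qed.

Lemma not_has_prefix1 X : free_tuples x -> X <> [::] -> ~ has_prefix X 1.
Proof. by move=> xfree X0 [r [/xfree]]; case: X X0 => // k X _; apply. Qed.

End SignedElements.

Lemma free_tuples_conj (K L : Type) (F : groupType) (x : K -> F)
    (X : L -> bool -> seq K) (g : L -> F) (v : F)
    (E := fun l e => word_eval x (pos_word (X l e))) :
  free_tuples x -> (forall l e, X l e <> [::]) ->
  (forall l e l' e', l <> l' \/ e <> e' -> incomparable (X l e) (X l' e')) ->
  switches x true v ->
  (forall l, switches x false ((E l true)^-1 * g l * E l false)) ->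
  free_tuples (fun l =>
    E l true * v * (E l true)^-1 * g l * E l false * v * (E l false)^-1).
Proof.
move=> xfree X0 XI vP gP; set h := fun l => _.
pose k l := (E l true)^-1 * g l * E l false.
(* Inversion of [h l] exchanges [E l true] with [E l false] and inverts [v] and [k l], so one
   formula serves both exponents. *)
have hE (a : L * bool) : (if a.2 then h a.1 else (h a.1)^-1) =
    E a.1 a.2 * ((if a.2 then v else v^-1) *
      ((if a.2 then k a.1 else (k a.1)^-1) *
      ((if a.2 then v else v^-1) * (E a.1 (~~ a.2))^-1))).
  by case: a => l [] /=; rewrite /h /k ?invgM ?invgK !mulgA.
have vB (e : bool) y : begins x false y -> begins x true ((if e then v else v^-1) * y).
  by case: e => By; apply: (switches_mul (e := true)) => //; exact: switches_inv.
have kB (e : bool) l y : begins x true y ->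
    begins x false ((if e then k l else (k l)^-1) * y).
  by case: e => By; apply: (switches_mul (e := false)) => //;
    [|apply: switches_inv]; exact: gP.
apply: (@ping_pong _ _ h (fun a => has_prefix x (X a.1 a.2))) => [a|a|a b y ab Py].
- exact: not_has_prefix1.
- rewrite hE; apply: has_prefix_mul => //; apply/vB/kB/vB; exact: begins_inv.
rewrite hE -!mulgA; apply: has_prefix_mul => //; apply/vB/kB/vB.
apply: begins_inv_mul Py; apply: XI.
(* A reduced pair excludes [b = (a.1, ~~ a.2)], so the prefix of [y] and the word inverted in front
   of it have different indices. *)
move: ab; rewrite reduced_cons2 andbT => /asboolP ab.
have [lE|] := pselect (b.1 = a.1); last by left.
by right; rewrite -(ab (esym lE)); case: a.2.
Qed.

(** * Forcing signs with two basis elements *)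

Section RankTwo.
Context {K : Type} {F : groupType} (x : K -> F).

Lemma word_eval_nseq n a :
  word_eval x (nseq n a) = (if a.2 then x a.1 else (x a.1)^-1) ^+ n.
Proof.
elim: n => [|n IH]; first exact: word_eval_nil.
by rewrite /= word_eval_cons IH expgS.
Qed.

Lemma strip_prefix (T : Type) (a : T) (w : seq T) :
  exists n r, w = nseq n a ++ r /\ forall r', r <> a :: r'.
Proof.
elim: w => [|b w [n [r [wE ra]]]]; first by exists 0, [::].
have [->|ba] := pselect (b = a); first by exists n.+1, r; rewrite wE.
by exists 0, (b :: w); split=> // r' [].
Qed.

(** A reduced word of [g] is split as a power of [p], a middle part and a power of [q^-1], where the
    middle part neither starts with [p] nor ends with [q^-1]. *)
Lemma exists_switches_mul (p q : K) (g : F) : (forall y, exists w, word_eval x w = y) ->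
  p <> q -> exists n m, switches x false
    ((word_eval x (pos_word (nseq n p)))^-1 * g * word_eval x (pos_word (nseq m q))).
Proof.
move=> gen pq; have [w0 <-] := gen g; have [w rw <-] := word_eval_reduced x w0.
have [n [r [wE rp]]] := strip_prefix (p, true) w.
have [m [s [rE sq]]] := strip_prefix (q, false) (rev r).
have {}rE : r = rev s ++ nseq m (q, false).
  by rewrite -(revK r) rE rev_cat rev_nseq.
have rs : reduced (rev s).
  by move: rw; rewrite wE rE => /reduced_catr/reduced_catl.
have sp s' : rev s <> (p, true) :: s'.
  by move=> sE; apply: (rp (s' ++ nseq m (q, false))); rewrite rE sE.
(* One power more than cancellation requires leaves [p^-1] before and [q] after the middle part. *)
exists n.+1, m.+1, ((p, false) :: rcons (rev s) (q, true)).
have lastE : last_sign ((p, false) :: rcons (rev s) (q, true)) = Some true.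
  by rewrite /last_sign -rcons_cons rev_rcons.
split=> //.
  have rs' : reduced (rcons (rev s) (q, true)).
    case: s sq rs {rE sp lastE} => // b s sq; rewrite rev_cons => rs.
    rewrite -cats1 cat_rcons /reduced sorted_cat_cons [X in X && _]rs /= andbT.
    apply/asboolP => bq; case: b bq sq {rs} => k [] //= -> sq.
    by case: (sq s).
  (* If the middle part is empty, [p^-1 q] is reduced because [p <> q]. *)
  case: (rev s) sp rs' => [_ _|[k e] s' sp rs'].
    by rewrite /= andbT; apply/asboolP.
  rewrite rcons_cons reduced_cons2 -rcons_cons rs' andbT; apply/asboolP => /= pk.
  by case: e sp {rs'} => // /(_ s'); rewrite pk.
rewrite wE rE /pos_word !map_nseq !word_eval_cat !word_eval_nseq /=.
rewrite word_eval_cons -cats1 word_eval_cat word_eval_cons word_eval_nil mulg1 /=.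
rewrite [x p ^+ _]expgSr [x q ^+ m.+1]expgS invgM expVgn !mulgA.
rewrite mulgVK -!mulgA; congr (_ * (_ * _)).
by rewrite -expgS expgSr mulKg.
Qed.

Definition inv_letter (a : K * bool) := (a.1, ~~ a.2).

Lemma word_eval_conj a w : word_eval x (a :: rcons w (inv_letter a)) =
  word_eval x [:: a] * word_eval x w * (word_eval x [:: a])^-1.
Proof.
rewrite word_eval_cons -cats1 word_eval_cat !word_eval_cons word_eval_nil !mulg1.
by rewrite !mulgA; case: a => k []; rewrite //= invgK.
Qed.

Lemma reduced_conj a w : w <> [::] -> reduced w ->
  (a.1 = (head a w).1 -> a.2 = (head a w).2) ->
  ((last a w).1 = a.1 -> (last a w).2 = ~~ a.2) ->
  reduced (a :: rcons w (inv_letter a)).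
Proof.
case/lastP: w => // w b _ rw; rewrite last_rcons => aw ba.
have rwa : reduced (rcons (rcons w b) (inv_letter a)).
  by rewrite -cats1 reduced_rcons_cons rw /= andbT; apply/asboolP.
case: w aw rwa {rw} => [|c w] /= ac rwa;
  by apply/andP; split=> //; apply/asboolP.
Qed.

Lemma first_sign_conj a w : first_sign (a :: rcons w (inv_letter a)) = Some a.2.
Proof. by []. Qed.

Lemma last_sign_conj a w : last_sign (a :: rcons w (inv_letter a)) = Some (~~ a.2).
Proof. by rewrite /last_sign -rcons_cons rev_rcons. Qed.

(** Conjugation by [x k] creates no cancellation unless [u] starts with [k^-1] or ends with [k]. If
    both [p] and [q] fail, one fails at the start and the other at the end; then conjugation by
    [p^-1] is reduced, and its result starts with [p^-1] and ends with [p], which suits [q]. *)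
Lemma conj_switches (p q : K) (u : F) : (forall y, exists w, word_eval x w = y) ->
  p <> q -> u <> 1 ->
  [\/ switches x true (x p * u * (x p)^-1),
      switches x true (x q * u * (x q)^-1) |
      switches x true (x q * (x p)^-1 * u * (x q * (x p)^-1)^-1)].
Proof.
move=> gen pq u1; have [w0 w0E] := gen u; have [w rw wE] := word_eval_reduced x w0.
have {w0 w0E} {}wE : word_eval x w = u by rewrite wE.
have w0 : w <> [::] by move=> w0; apply: u1; rewrite -wE w0 word_eval_nil.
have one k e : word_eval x [:: (k, e)] = if e then x k else (x k)^-1.
  by rewrite word_eval_cons word_eval_nil mulg1.
(* The defaults of [head] and [last] are immaterial, as [w] is nonempty. *)
pose good k := (forall a, head a w <> (k, false)) /\ (forall a, last a w <> (k, true)).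
have goodP k : good k -> switches x true (x k * u * (x k)^-1).
  move=> [hk lk]; exists ((k, true) :: rcons w (inv_letter (k, true))); split.
  - apply: reduced_conj => //=.
      by move: (hk (k, true)); case: (head _ _) => k' [] //= + kk'; rewrite kk'.
    by move: (lk (k, true)); case: (last _ _) => k' [] //= + kk'; rewrite kk'.
  - exact: first_sign_conj.
  - exact: last_sign_conj.
  - by rewrite word_eval_conj one wE.
have [gp|ngp] := pselect (good p); first by constructor 1; exact: goodP.
have [gq|ngq] := pselect (good q); first by constructor 2; exact: goodP.
constructor 3.
pose w1 := (p, false) :: rcons w (inv_letter (p, false)).
have rw1 : reduced w1.
  have hE a b : head a w = head b w by case: (w) w0.
  have lE a b : last a w = last b w by case: (w) w0.
  have H k : ~ good k -> head (p, false) w = (k, false) \/ last (p, false) w = (k, true).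
    move=> ng; apply: contrapT => /not_orP[n1 n2]; apply: ng; split=> a.
      by rewrite (hE _ (p, false)).
    by rewrite (lE _ (p, false)).
  apply: reduced_conj => //=.
    by case: (H _ ngp) => [->//|lp]; case: (H _ ngq) => [->//|]; rewrite lp => -[/pq].
  by case: (H _ ngp) => [hp|->//]; case: (H _ ngq) => [|->//]; rewrite hp => -[/pq].
exists ((q, true) :: rcons w1 (inv_letter (q, true))); split.
- apply: reduced_conj => //; rewrite /w1 /= ?last_rcons /=; first by move=> /esym/pq.
  by move=> /pq.
- exact: first_sign_conj.
- exact: last_sign_conj.
- by rewrite !word_eval_conj !one wE /= invgM !invgK !mulgA.
Qed.

End RankTwo.

(** * Small perturbations in a non-discrete group *)

Section Topology.
Context {F : topologicalGroupType}.

Lemma cvg_mulg (T : Type) (Fi : set_system T) {FF : Filter Fi} (f g : T -> F) (a b : F) :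
  f @ Fi --> a -> g @ Fi --> b -> (fun t => f t * g t) @ Fi --> a * b.
Proof. by apply: continuous2_cvg; exact: (mulg_continuous (a, b)). Qed.

Lemma continuous_ptws (T : topologicalType) (L : Type) (f : T -> L -> F) :
  (forall l, continuous (f^~ l)) -> continuous (f : T -> {ptws L -> F}).
Proof.
move=> fc y; apply/cvg_sup => l; move: y.
apply/(@continuousP _ (initial_topology (fun h : L -> F => h l))) => A [B oB <-].
by rewrite -comp_preimage; move/continuousP: (fc l); apply.
Qed.

(** Otherwise the translates of [N] would make each point a neighbourhood of itself. *)
Lemma nondiscrete_nbhs1 (N : set F) : ~ (forall A : set F, open A) ->
  nbhs (1 : F) N -> exists2 u, N u & u <> 1.
Proof.
move=> nd N1; apply: contrapT => nN; apply: nd => A.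
rewrite openE => a Aa; rewrite /interior.
have : (fun y => a^-1 * y) @ a --> (1 : F).
  by rewrite -(mulVg a); apply: cvg_mulg; [exact: cvg_cst|exact: cvg_id].
move=> /(_ _ N1); apply: (@filterS _ (nbhs a)) => y Ny.
have [/(congr1 (mul a))|y1] := pselect (a^-1 * y = 1).
  by rewrite mulVKg mulg1 => ->.
by exfalso; apply: nN; exists (a^-1 * y).
Qed.

Lemma dense_free_tuples (K L : Type) (x : K -> F) (p q : K) (c : L -> seq K) :
  ~ (forall A : set F, open A) -> free_tuples x ->
  (forall y : F, exists w, word_eval x w = y) -> p <> q ->
  (forall l l' r r', c l ++ r = c l' ++ r' -> l = l') ->
  dense (@free_tuples L F : set {ptws L -> F}).
Proof.
move=> nd xfree gen pq cP O [g Og] oO.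
pose ev X : F := word_eval x (pos_word X).
have evM X Y : ev (X ++ Y) = ev X * ev Y by rewrite /ev /pos_word map_cat word_eval_cat.
(* The exponents are chosen after [p c_l] and [q c_l] have been absorbed into [g l], since they are
   appended behind these prefixes. *)
have /choice[n nP] (l : L) :=
  exists_switches_mul ((ev (p :: c l))^-1 * g l * ev (q :: c l)) gen pq.
have {nP} /choice[m nmP] := nP.
pose X l (e : bool) :=
  if e then p :: c l ++ nseq (n l) p else q :: c l ++ nseq (m l) q.
pose E l e := ev (X l e).
have gP l : switches x false ((E l true)^-1 * g l * E l false).
  by have := nmP l; rewrite /E /X -!cat_cons !evM invgM !mulgA.
(* The first letters [p] and [q] separate the two families; within a family [c] separates the
   indices, whatever the exponents. *)
have XP l e l' e' : l <> l' \/ e <> e' -> incomparable (X l e) (X l' e').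
  move=> H r s; case: e e' H => [] [] H; rewrite /X !cat_cons -!catA.
  - by case=> /cP ll'; case: H.
  - by case=> /pq.
  - by case=> /esym/pq.
  - by case=> /cP ll'; case: H.
pose phi t u l :=
  E l true * (t * u * t^-1) * (E l true)^-1 * g l * E l false * (t * u * t^-1) *
    (E l false)^-1.
have phi1 t : phi t 1 = g.
  by apply/funext => l; rewrite /phi !(mulg1, mulgV, mul1g) mulgK.
have phiO t : nbhs (1 : F) [set u | O (phi t u)].
  have /(_ 1) : continuous (phi t : F -> {ptws L -> F}).
    apply: continuous_ptws => l u.
    by do ?[exact: cvg_cst | exact: cvg_id | refine (cvg_mulg _ _)].
  by apply; rewrite phi1; exact: open_nbhs_nbhs.
(* The right conjugator depends on [u], so [u] is taken close to 1 for all three candidates at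
   once. *)
have [u [Op [Oq Oqp]] u1] := nondiscrete_nbhs1 nd
  (filterI (phiO (x p)) (filterI (phiO (x q)) (phiO (x q * (x p)^-1)))).
have [t Ot vP] : exists2 t, O (phi t u) & switches x true (t * u * t^-1).
  by case: (conj_switches gen pq u1) => ?;
    [exists (x p)|exists (x q)|exists (x q * (x p)^-1)].
exists (phi t u); split=> //.
by apply: (@free_tuples_conj _ _ _ x X g) => // l [].
Qed.

End Topology.

(** * Rank one *)

Section RankOne.
Context {K : Type} (k0 : K) (K1 : forall k, k = k0).

Lemma reduced_rank1 (w : word K) : reduced w -> exists n e, w = nseq n (k0, e).
Proof.
elim: w => [|[k e] w IH] rw; first by exists 0, true.
have [] := IH (@reduced_catr _ [:: (k, e)] _ rw) => -[|n] [e' wE].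
  by exists 1%N, e; rewrite wE (K1 k).
exists n.+2, e; move: rw; rewrite wE (K1 k) /= => /andP[/asboolP/= ee _].
by rewrite ee.
Qed.

Lemma free_tuples_rank1 (F : groupType) (x h : K -> F) :
  free_tuples x -> (forall y : F, exists w, word_eval x w = y) ->
  h k0 <> 1 -> free_tuples h.
Proof.
move=> xfree gen h1 w /reduced_rank1[[|n] [e ->]] // _.
rewrite word_eval_nseq /= => hn1.
have {}hn1 : h k0 ^+ n.+1 = 1.
  by case: e hn1 => //= hn1; apply: invg_inj; rewrite invg1 -expVgn.
have [w0 w0E] := gen (h k0); have [r rr rE] := word_eval_reduced x w0.
have {w0E}rE : word_eval x r = h k0 by rewrite rE.
have [[|m] [e' rE']] := reduced_rank1 rr.
  by apply: h1; rewrite -rE rE' word_eval_nil.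
(* The relation [h k0 ^+ n.+1 = 1], rewritten in the basis element, is a nontrivial power equal to
   1. *)
apply: (xfree (nseq (m.+1 * n.+1) (k0, e'))) => //; first exact: reduced_nseq.
by rewrite word_eval_nseq expgnA -word_eval_nseq -rE' rE.
Qed.

End RankOne.

(** * Infinitude and the equivalence *)

Lemma free_infinite (K : Type) (k : K) (F : groupType) (x : K -> F) :
  free_tuples x -> infinite_set [set: F].
Proof.
move=> xfree.
have neq i j : (i < j)%N -> x k ^+ i <> x k ^+ j.
  move=> ij eqij; apply: (xfree (nseq (j - i) (k, true))).
  - exact: reduced_nseq.
  - by move: ij; rewrite -subn_gt0; case: (j - i)%N.
  - by rewrite word_eval_nseq expgnFr 1?ltnW // eqij mulgV.
have inj : injective (fun n => x k ^+ n).
  by move=> i j eqij; case: (ltngtP i j) => // /neq; rewrite eqij.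
by move/(finite_preimage (f := fun n => x k ^+ n) (in2W inj))/infinite_nat.
Qed.

Theorem proposition12 (K : Type) (F : topologicalGroupType)
    (K_gt0 : [set: K] !=set0) (F_free : free_of_rank K F) :
  ((~ forall A : set F, open A) <-> almost_free K F) /\
  (almost_free K F ->
   (`I_2 #<= [set: K])%card -> countable [set: K] ->
   almost_countably_free F).
Proof.
have [k0 _] := K_gt0; have [x xfree gen] := F_free.
have Finf := free_infinite k0 xfree.
have nondisc : almost_free K F -> ~ forall A : set F, open A.
  move=> [_ dF] disc.
  have oO : open ([set h | h k0 = 1] : set {ptws K -> F}).
    rewrite (_ : mkset _ = (fun h : {ptws K -> F} => h k0) @^-1` [set 1]) //.
    have /continuousP : continuous (fun h : {ptws K -> F} => h k0).
      exact: (@proj_continuous {classic K} (fun _ => F) k0).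
    by apply; exact: disc.
  have [|h [hk /(_ [:: (k0, true)])]] := dF _ _ oO; first by exists (fun _ => 1).
  by rewrite word_eval_cons word_eval_nil mulg1; apply.
split; first split=> // nd.
  split=> //; have [[q qk0]|nq] := pselect (exists q, k0 <> q).
    by apply: (dense_free_tuples (c := fun k : K => [:: k]) nd xfree gen qk0) => l l' r r' [].
  have K1 k : k = k0 by apply: contrapT => kk0; apply: nq; exists k => /esym.
  move=> O [g Og] oO.
  suff [h Oh h1] : exists2 h : K -> F, O h & h k0 <> 1.
    by exists h; split=> //; exact: (free_tuples_rank1 K1 xfree gen h1).
  have [g1|g1] := pselect (g k0 = 1); last by exists g.
  have : nbhs (1 : F) [set u | O (fun _ => u)].
    (* With a single index every tuple is constant, so the diagonal map carries a neighbourhood of 1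
       into [O]. *)
    have /(_ 1) : continuous ((fun u _ => u) : F -> {ptws K -> F}).
      by apply: continuous_ptws => l u; exact: cvg_id.
    apply; apply: open_nbhs_nbhs; split=> //.
    by rewrite (_ : (fun _ => 1) = g) //; apply/funext => k; rewrite (K1 k).
  by move=> /(nondiscrete_nbhs1 nd)[u Ou u1]; exists (fun _ => u).
move=> /nondisc nd K2 _.
have [p [q pq]] : exists p q : K, p <> q.
  apply: contrapT => nK; move: K2; rewrite (_ : [set: K] = [set k0]).
    by rewrite (card_le_eqr card_set1) card_le_II.
  apply/seteqP; split=> // k _; apply: contrapT => kk0.
  by apply: nK; exists k, k0.
split=> //.
apply: (dense_free_tuples (c := fun n => nseq n p ++ [:: q]) nd xfree gen pq).
(* In [p^l q] the position of the first [q] recovers [l]. *)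
elim=> [|l IH] [|l'] r r' //=.
- by case=> /esym/pq.
- by case=> /pq.
- by case=> /IH ->.
Qed.
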